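(* Let $G$ be the group whose elements are the triples $(i,j,s)\in\mathbb{Z}^3$, written as formal monomials $x^iy^jz^s$, with multiplication $$x^iy^jz^s\cdot x^{i'}y^{j'}z^{s'}=x^{i+i'}y^{j+j'}z^{s+s'+ij'},$$ and let $\mathbb{Z}[G]$ be its integral group ring (finite formal $\mathbb{Z}$-linear combinations $\sum a(i,j,s)\,x^iy^jz^s$, with multiplication extended bilinearly from that of $G$). In $\mathbb{Z}[G]$ let $x=x^1y^0z^0$, $x^{-1}=x^{-1}y^0z^0$, $y=x^0y^1z^0$, $y^{-1}=x^0y^{-1}z^0$, and put $\mathfrak{w}=x+x^{-1}+y+y^{-1}$. For integers $n\ge 0$ and $p,q,s$, let $w_n(p,q,s)$ be the number of walks of length $n$ in the square lattice which begin at the origin, end at $(p,q)$, and have area $s$. Then $w_n(p,q,s)$ equals the coefficient of $x^py^qz^s$ in $\mathfrak{w}^n$, the power being computed in $\mathbb{Z}[G]$.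
   Context: A walk of length $n$ in the square lattice is a sequence of points $[(x_0,y_0),(x_1,y_1),\ldots,(x_n,y_n)]$ of $\mathbb{Z}^2$ such that for each $0\le i\le n-1$ one has $\{|x_{i+1}-x_i|,|y_{i+1}-y_i|\}=\{0,1\}$. The area of such a walk $Q$ (not necessarily closed) is defined as $$S(Q)=\sum_{i=0}^{n-1} x_i(y_{i+1}-y_i)+x_0(y_0-y_n);$$ for a walk beginning at the origin this is $\sum_{i=0}^{n-1} x_i(y_{i+1}-y_i)$. Note that in $\mathbb{Z}[G]$ the monomial $x^iy^jz^s$ denotes the group element $(i,j,s)$ and is in general not the product $x^i\cdot y^j\cdot z^s$. *)

(* Defs.v *)
From HB Require Import structures.
From mathcomp Require Import all_boot all_order all_algebra finmap.
From mathcomp Require Import classical_sets functions cardinality.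
From mathcomp.multinomials Require Import monalg.
From mathcomp Require Import ring zify.

Set Implicit Arguments.
Unset Strict Implicit.
Unset Printing Implicit Defensive.

Import Order.TTheory GRing.Theory Num.Theory.

Local Open Scope ring_scope.

(* Integral group ring of an arbitrary group. The finitely supported functions
   {malg int[G]} provide the additive group; their library product is only
   available for monoids without nontrivial units, which excludes groups. *)
Definition group_ring (G : groupType) : Type := {malg int[G]}.

HB.instance Definition _ (G : groupType) :=
  GRing.Zmodule.copy (group_ring G) {malg int[G]}.

Section GroupRing.
Variable G : groupType.
Implicit Types (a b c : group_ring G) (g h : G).

Definition gr_coef a g : int := mcoeff g a.

Definition gr_elt g : group_ring G := << g >>.

Definition gr_one : group_ring G := gr_elt 1%g.

Definition gr_mul a b : group_ring G :=
  \sum_(g <- msupp a) \sum_(h <- msupp b) << mcoeff g a * mcoeff h b *g (g * h)%g >>.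

Let gr_mulw (d1 d2 : {fset G}) a b :
  (msupp a `<=` d1)%fset -> (msupp b `<=` d2)%fset ->
  gr_mul a b = \sum_(g <- d1) \sum_(h <- d2)
                 << mcoeff g a * mcoeff h b *g (g * h)%g >>.
Proof.
move=> le_d1 le_d2; rewrite /gr_mul (big_fset_incl _ le_d1) /=.
  apply/eq_bigr=> g _; apply/big_fset_incl => // h _ /mcoeff_outdom ->.
  by rewrite mulr0 monalgU0.
move=> g _ /mcoeff_outdom ag.
by rewrite big1 // => h _; rewrite ag mul0r monalgU0.
Qed.

Let gr_mulDl : left_distributive gr_mul +%R.
Proof.
move=> a b c; pose d := (msupp a `|` msupp b)%fset.
rewrite (gr_mulw (msuppD_le a b : (_ `<=` d)%fset) (fsubset_refl _)).
rewrite (gr_mulw (fsubsetUl _ _ : (_ `<=` d)%fset) (fsubset_refl _)).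
rewrite (gr_mulw (fsubsetUr _ _ : (_ `<=` d)%fset) (fsubset_refl _)).
rewrite -big_split /=; apply/eq_bigr=> g _.
rewrite -big_split /=; apply/eq_bigr=> h _.
by rewrite mcoeffD mulrDl monalgUD.
Qed.

Let gr_mulDr : right_distributive gr_mul +%R.
Proof.
move=> c a b; pose d := (msupp a `|` msupp b)%fset.
rewrite (gr_mulw (fsubset_refl _) (msuppD_le a b : (_ `<=` d)%fset)).
rewrite (gr_mulw (fsubset_refl _) (fsubsetUl _ _ : (_ `<=` d)%fset)).
rewrite (gr_mulw (fsubset_refl _) (fsubsetUr _ _ : (_ `<=` d)%fset)).
rewrite -big_split /=; apply/eq_bigr=> g _.
rewrite -big_split /=; apply/eq_bigr=> h _.
by rewrite mcoeffD mulrDr monalgUD.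
Qed.

Let gr_mul0 : left_zero 0 gr_mul.
Proof. by move=> a; rewrite /gr_mul msupp0 big_seq_fset0. Qed.

Let gr_mul0r : right_zero 0 gr_mul.
Proof.
by move=> a; rewrite /gr_mul big1 // => g _; rewrite msupp0 big_seq_fset0.
Qed.

Let gr_mulUU (x y : int) g h :
  gr_mul << x *g g >> << y *g h >> = << x * y *g (g * h)%g >>.
Proof.
by rewrite (gr_mulw msuppU_le msuppU_le) !big_seq_fset1 !mcoeffUU.
Qed.

Let gr_ind (P : group_ring G -> Prop) :
  P 0 -> (forall a b, P a -> P b -> P (a + b)) ->
  (forall x g, P << x *g g >>) -> forall a, P a.
Proof.
move=> P0 PD PU a.
have -> : a = \sum_(g <- msupp a) << mcoeff g a *g g >> :> group_ring G.
  exact: monalgE.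
by apply: (big_ind P) => // *; apply: PD.
Qed.

Let gr_mulA : associative gr_mul.
Proof.
move=> a b c; elim/gr_ind: a => [|a a' IH IH'|x g].
- by rewrite !gr_mul0.
- by rewrite !gr_mulDl IH IH'.
elim/gr_ind: b => [|b b' IH IH'|y h].
- by rewrite gr_mul0r !gr_mul0 gr_mul0r.
- by rewrite gr_mulDl !gr_mulDr gr_mulDl IH IH'.
elim/gr_ind: c => [|c c' IH IH'|z k].
- by rewrite !gr_mul0r.
- by rewrite !gr_mulDr IH IH'.
by rewrite !gr_mulUU mulrA mulgA.
Qed.

Let gr_mul1 : left_id gr_one gr_mul.
Proof.
elim/gr_ind => [|a a' IH IH'|x g]; first by rewrite gr_mul0r.
  by rewrite gr_mulDr IH IH'.
by rewrite gr_mulUU mul1r mul1g.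
Qed.

Let gr_mul1r : right_id gr_one gr_mul.
Proof.
elim/gr_ind => [|a a' IH IH'|x g]; first by rewrite gr_mul0.
  by rewrite gr_mulDl IH IH'.
by rewrite gr_mulUU mulr1 mulg1.
Qed.

Let gr_one_neq0 : gr_one != 0.
Proof.
by apply/eqP => /(congr1 (mcoeff (1%g : G))); rewrite mcoeffUU mcoeff0.
Qed.

HB.instance Definition _ := GRing.Zmodule_isNzRing.Build (group_ring G)
  gr_mulA gr_mul1 gr_mul1r gr_mulDl gr_mulDr gr_one_neq0.

End GroupRing.

(* Heis i j s is the group element written x^i y^j z^s. *)
Record heis : predArgType := Heis { hx : int; hy : int; hz : int }.

Definition heis_to_triple (g : heis) := (hx g, hy g, hz g).
Definition triple_to_heis (t : int * int * int) := Heis t.1.1 t.1.2 t.2.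
Lemma heis_to_tripleK : cancel heis_to_triple triple_to_heis.
Proof. by case. Qed.
HB.instance Definition _ := Choice.copy heis (can_type heis_to_tripleK).

Definition heis_one := Heis 0 0 0.
Definition heis_mul (g h : heis) :=
  Heis (hx g + hx h) (hy g + hy h) (hz g + hz h + hx g * hy h).
Definition heis_inv (g : heis) := Heis (- hx g) (- hy g) (hx g * hy g - hz g).

Lemma heis_mulA : associative heis_mul.
Proof. by move=> g h k; rewrite /heis_mul /=; f_equal; ring. Qed.
Lemma heis_mul1 : left_id heis_one heis_mul.
Proof. by case=> i j s; rewrite /heis_mul /=; f_equal; ring. Qed.
Lemma heis_mul1r : right_id heis_one heis_mul.
Proof. by case=> i j s; rewrite /heis_mul /=; f_equal; ring. Qed.
Lemma heis_mulV : left_inverse heis_one heis_inv heis_mul.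
Proof. by case=> i j s; rewrite /heis_mul /heis_one /=; f_equal; ring. Qed.
Lemma heis_mulVr : right_inverse heis_one heis_inv heis_mul.
Proof. by case=> i j s; rewrite /heis_mul /heis_one /=; f_equal; ring. Qed.
HB.instance Definition _ := isGroup.Build heis
  heis_mulA heis_mul1 heis_mul1r heis_mulV heis_mulVr.

Definition frakw : group_ring heis :=
  gr_elt (Heis 1 0 0) + gr_elt (Heis (-1) 0 0)
  + gr_elt (Heis 0 1 0) + gr_elt (Heis 0 (-1) 0).

Section Walks.
Variable n : nat.
Implicit Types Q : n.+1.-tuple (int * int).

Definition xco Q (i : nat) : int := (nth (0, 0) Q i).1.
Definition yco Q (i : nat) : int := (nth (0, 0) Q i).2.

Definition is_walk Q : Prop := forall i : nat, (i < n)%N ->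
  [fset `|xco Q i.+1 - xco Q i|; `|yco Q i.+1 - yco Q i|]%fset
    = [fset 0; 1]%fset :> {fset int}.

Definition area Q : int :=
  (\sum_(i < n) xco Q i * (yco Q i.+1 - yco Q i))
  + xco Q 0 * (yco Q 0 - yco Q n).

Definition walks (p q s : int) : set (n.+1.-tuple (int * int)) :=
  [set Q | [/\ is_walk Q, (xco Q 0, yco Q 0) = (0, 0),
               (xco Q n, yco Q n) = (p, q) & area Q = s]]%classic.

Lemma finite_walks (p q s : int) : finite_set (walks p q s).
Proof.
have walk_le Q : is_walk Q -> (xco Q 0, yco Q 0) = (0, 0) ->
    forall i, (i <= n)%N -> `|xco Q i| <= n%:Z /\ `|yco Q i| <= n%:Z.
  move=> wQ [x0 y0] i lein.
  have H : `|xco Q i| <= i%:Z /\ `|yco Q i| <= i%:Z.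
    elim: i lein => [|i IH] lein; first by rewrite x0 y0.
    have [hx hy] := IH (ltnW lein).
    have E := wQ i lein.
    have : `|xco Q i.+1 - xco Q i| \in [fset 0; 1 : int]%fset.
      by rewrite -E !inE eqxx.
    have : `|yco Q i.+1 - yco Q i| \in [fset 0; 1 : int]%fset.
      by rewrite -E !inE eqxx orbT.
    by rewrite !inE => /orP[]/eqP ? /orP[]/eqP ?; lia.
  by move: H; lia.
pose I := 'I_(n + n).+1.
pose dec (k : I) : int := k%:Z - n%:Z.
pose f (t : n.+1.-tuple (I * I)) : n.+1.-tuple (int * int) :=
  map_tuple (fun k => (dec k.1, dec k.2)) t.
pose enc (z : int) : I := inord (absz (z + n%:Z)).
have encK z : `|z| <= n%:Z -> dec (enc z) = z.
  by move=> hz; rewrite /dec /enc inordK; lia.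
have fin : finite_set (f @` [set: n.+1.-tuple (I * I)])%classic.
  by apply: finite_image; exact: finite_finset.
apply: sub_finite_set fin => Q [wQ oQ _ _].
exists (map_tuple (fun z => (enc z.1, enc z.2)) Q) => //.
apply: val_inj => /=; rewrite -map_comp -[RHS]map_id.
apply/eq_in_map => z zQ /=.
have [] := walk_le Q wQ oQ (index z Q).
  by rewrite -ltnS -[X in (_ < X)%N](size_tuple Q) index_mem.
by rewrite /xco /yco nth_index //= => ? ?; rewrite !encK -?surjective_pairing.
Qed.

(* fset_set is meaningful on finite sets only, see finite_walks. *)
Definition nb_walks (p q s : int) : nat := #|` fset_set (walks p q s)|.

End Walks.

(* Main.v *)
(* Reading a walk from the origin as the product of its steps in G, right
   multiplication by a step moves the end point along that step and adds
   [x_i * (y_(i+1) - y_i)] to the exponent of z, which is exactly the increment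
   of the area. Hence expanding w^n gives one group element per walk, namely
   the one recording its end point and area. *)
Require Import Defs.
From mathcomp Require Import all_boot all_order all_algebra.
From mathcomp Require Import finmap classical_sets functions cardinality.
From mathcomp.multinomials Require Import monalg.
From mathcomp Require Import zify.

Set Implicit Arguments.
Unset Strict Implicit.
Unset Printing Implicit Defensive.

Import Order.TTheory GRing.Theory Num.Theory.

Local Open Scope ring_scope.

Lemma gr_eltM (G : groupType) (g h : G) :
  gr_elt g * gr_elt h = gr_elt (g * h)%g.
Proof.
rewrite [LHS]/(gr_mul _ _) /gr_mul /gr_elt !msuppU oner_eq0 !big_seq_fset1.
by rewrite !mcoeffUU mulr1.
Qed.

(** Each summand contributes 1 or 0 to the coefficient at [g], so reading off a coefficient becomes
    counting indices. *)
Lemma gr_coef_sum (G : groupType) (I : Type) (r : seq I) (F : I -> G) (g : G) :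
  gr_coef (\sum_(i <- r) gr_elt (F i)) g = (count (fun i => F i == g) r)%:Z.
Proof.
elim: r => [|i r IH]; first by rewrite big_nil /gr_coef mcoeff0.
rewrite big_cons /gr_coef mcoeffD mcoeffU -/(gr_coef _ _) IH [RHS]PoszD.
by rewrite pmulrn intz.
Qed.

(** Listed in the order of the summands of [frakw], so that the sums agree term by term. *)
Definition steps : seq (int * int) := [:: (1, 0); (-1, 0); (0, 1); (0, -1)].

Lemma big_steps (V : nmodType) (f : int * int -> V) :
  \sum_(d <- steps) f d = f (1, 0) + f (-1, 0) + f (0, 1) + f (0, -1).
Proof. by rewrite !big_cons big_nil addr0 !addrA. Qed.

Lemma frakwE : frakw = \sum_(d <- steps) gr_elt (Heis d.1 d.2 0).
Proof. by rewrite big_steps. Qed.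

Lemma mem_steps (a b : int) :
  [fset `|a|; `|b|]%fset = [fset 0; 1]%fset :> {fset int} <-> (a, b) \in steps.
Proof.
split=> [E|].
  (* Four memberships extracted from the set equality turn it into linear arithmetic: both absolute
     values lie in {0, 1}, and both 0 and 1 occur. *)
  have : `|a| \in [fset 0; 1 : int]%fset by rewrite -E !inE eqxx.
  have : `|b| \in [fset 0; 1 : int]%fset by rewrite -E !inE eqxx orbT.
  have : 0 \in [fset `|a|; `|b|]%fset by rewrite E !inE eqxx.
  have : 1 \in [fset `|a|; `|b|]%fset by rewrite E !inE eqxx orbT.
  rewrite !inE !xpair_eqE; lia.
rewrite !inE => /or4P[] /eqP[-> ->]; rewrite ?normrN normr0 normr1 //;
  exact: fsetUC.
Qed.

Definition endpt n (Q : n.+1.-tuple (int * int)) : int * int :=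
  (xco Q n, yco Q n).

Definition walk_elt n (Q : n.+1.-tuple (int * int)) : heis :=
  Heis (xco Q n) (yco Q n) (area Q).

Section Extension.
Variable n : nat.
Implicit Types (Q : n.+1.-tuple (int * int)) (e : int * int).

Lemma nth_rcons_le Q e i : (i <= n)%N ->
  nth (0, 0) (rcons Q e) i = nth (0, 0) Q i.
Proof. by move=> le_in; rewrite nth_rcons size_tuple ltnS le_in. Qed.

Lemma nth_rcons_last Q e : nth (0, 0) (rcons Q e) n.+1 = e.
Proof. by rewrite nth_rcons size_tuple ltnn eqxx. Qed.

(** The conditions at indices below [n] only see [Q]; the one at index [n] only sees the new
    step. *)
Lemma is_walk_rcons Q e :
  is_walk (rcons_tuple Q e) <-> is_walk Q /\ e - endpt Q \in steps.
Proof.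
have Ei i : (i < n)%N ->
    [/\ xco (rcons_tuple Q e) i = xco Q i, yco (rcons_tuple Q e) i = yco Q i,
        xco (rcons_tuple Q e) i.+1 = xco Q i.+1 &
        yco (rcons_tuple Q e) i.+1 = yco Q i.+1].
  by move=> lt_in; rewrite /xco /yco /= !nth_rcons_le // ltnW.
have En : [/\ xco (rcons_tuple Q e) n = xco Q n,
    yco (rcons_tuple Q e) n = yco Q n,
    xco (rcons_tuple Q e) n.+1 = e.1 & yco (rcons_tuple Q e) n.+1 = e.2].
  by rewrite /xco /yco [tval _]/= !nth_rcons_last !nth_rcons_le.
split=> [wQ|[wQ de] i].
  split=> [i lt_in|].
    by have := wQ i (ltnW lt_in); case: (Ei i lt_in) => -> -> -> ->.
  by have := wQ n (ltnSn n); case: En => -> -> -> -> /mem_steps.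
rewrite ltnS leq_eqVlt => /orP[/eqP->|lt_in].
  by case: En => -> -> -> ->; apply/mem_steps.
by case: (Ei i lt_in) => -> -> -> ->; apply: wQ.
Qed.

(** Starting at abscissa 0 kills the closing term of [area], which would otherwise change with the
    end point. What remains gains [xco Q n * d.2], the twist in [heis_mul]. *)
Lemma walk_elt_rcons Q (d : int * int) : xco Q 0 = 0 ->
  walk_elt (rcons_tuple Q (endpt Q + d)) = (walk_elt Q * Heis d.1 d.2 0)%g.
Proof.
move=> x0; rewrite [RHS]/(heis_mul _ _) /heis_mul /walk_elt /area /=.
have -> : xco (rcons_tuple Q (endpt Q + d)) 0 = 0.
  by rewrite -x0 /xco /= nth_rcons_le.
rewrite x0 !mul0r !addr0 big_ord_recr /xco /yco [tval _]/=.
rewrite !nth_rcons_last !nth_rcons_le //=.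
congr Heis; congr (_ + _).
  by apply: eq_bigr => i _; rewrite !nth_rcons_le // ltnW.
by rewrite addrC addKr.
Qed.

End Extension.

(** An explicit list of the walks from the origin, built one step at a time so that it mirrors the
    expansion of [frakw ^+ n.+1] as [frakw ^+ n * frakw]. *)
Fixpoint walk_seq n : seq (n.+1.-tuple (int * int)) :=
  if n is m.+1 then
    [seq rcons_tuple Q (endpt Q + d) | Q <- walk_seq m, d <- steps]
  else [:: [tuple (0, 0)]].

(** An extended walk determines its prefix and its last point, hence its last step by
    subtraction. *)
Lemma walk_seq_uniq n : uniq (walk_seq n).
Proof.
elim: n => // n IH; apply: allpairs_uniq => //= -[Q d] [Q' d'] _ _ /= E.
have /eqP := rcons_inj (congr1 val E).
by rewrite xpair_eqE => /andP[/eqP/val_inj <- /eqP/addrI ->].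
Qed.

Lemma mem_walk_seq n (Q : n.+1.-tuple (int * int)) :
  Q \in walk_seq n <-> is_walk Q /\ (xco Q 0, yco Q 0) = (0, 0).
Proof.
elim: n Q => [|n IH] Q.
  rewrite inE; split=> [/eqP-> //|[_]].
  case: Q => -[|[a b] []] // sz [a0 b0]; apply/eqP/val_inj => /=.
  by move: a0 b0; rewrite /xco /yco /= => -> ->.
(* Detaching the last point exposes the shorter walk to which the induction hypothesis applies. *)
have [Q' [e ->]] : exists Q' : n.+1.-tuple (int * int), exists e,
    Q = rcons_tuple Q' e.
  case: Q => s sz; case/lastP: s sz => // s e sz.
  have sz' : size s == n.+1 by rewrite size_rcons in sz.
  by exists (Tuple sz'), e; apply: val_inj.
have -> : (xco (rcons_tuple Q' e) 0, yco (rcons_tuple Q' e) 0)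
    = (xco Q' 0, yco Q' 0).
  by rewrite /xco /yco /= nth_rcons_le.
rewrite is_walk_rcons; split=> [/allpairsP[[Q2 d] /= [Q2w ds E]]|[[wQ de] oQ]].
  have /eqP := rcons_inj (congr1 val E).
  rewrite xpair_eqE => /andP[/eqP/val_inj -> /eqP->].
  by have [wQ2 oQ2] := (IH Q2).1 Q2w; rewrite addrC addKr.
apply/allpairsP; exists (Q', e - endpt Q') => /=; split=> //; first exact/IH.
by rewrite addrC subrK.
Qed.

Lemma frakwX n : frakw ^+ n = \sum_(Q <- walk_seq n) gr_elt (walk_elt Q).
Proof.
elim: n => [|n IH].
  by rewrite big_seq1 /walk_elt /area big_ord0.
(* [big_seq] keeps the membership of [Q] in [walk_seq n], which yields the hypothesis [xco Q 0 = 0]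
   of [walk_elt_rcons]. *)
rewrite exprSr IH frakwE big_allpairs_dep mulr_suml big_seq [RHS]big_seq.
apply: eq_bigr => Q /mem_walk_seq[_ [x0 _]].
rewrite mulr_sumr; apply: eq_bigr => d _.
by rewrite gr_eltM walk_elt_rcons.
Qed.

Lemma nb_walksE n (p q s : int) :
  nb_walks n p q s = count (fun Q => walk_elt Q == Heis p q s) (walk_seq n).
Proof.
pose r := [seq Q <- walk_seq n | walk_elt Q == Heis p q s].
(* Both sides become cardinals of finite sets with the same elements; [undup] then disappears
   because [walk_seq n] has no repetition. *)
have -> : nb_walks n p q s = size (undup r).
  rewrite -card_fseq /nb_walks; congr #|` _|; apply/fsetP => Q.
  rewrite in_fset_set; last exact: finite_walks.
  rewrite inE mem_filter; apply/idP/andP.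
    rewrite inE => -[wQ oQ [<- <-] <-]; split=> //; exact/mem_walk_seq.
  by case=> /eqP[<- <- <-] /mem_walk_seq[wQ oQ]; rewrite inE.
by rewrite undup_id ?filter_uniq ?walk_seq_uniq // size_filter.
Qed.

Theorem theorem1 (n : nat) (p q s : int) :
  (nb_walks n p q s)%:Z = gr_coef (frakw ^+ n) (Heis p q s).
Proof. by rewrite frakwX gr_coef_sum nb_walksE. Qed.
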